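(* Let $k$ and $m$ be positive integers such that $\gcd(k,m)=1$ and $m<k<\sigma(m)$. If a positive integer $n$ has abundancy index $\lambda(n)=\frac{k}{k-m}$, then $n$ is not feebly amicable with any other positive integer; that is, there is no positive integer $l\neq n$ with $\frac{1}{\lambda(n)}+\frac{1}{\lambda(l)}=1$.
   Context: For a positive integer $n$, $\sigma(n)$ denotes the sum of all positive divisors of $n$ (including $n$), and the abundancy index is $\lambda(n)=\frac{\sigma(n)}{n}$. Two positive integers $m,n$ are called feebly amicable if $\frac{n}{\sigma(n)}+\frac{m}{\sigma(m)}=1$, equivalently $\frac{1}{\lambda(n)}+\frac{1}{\lambda(m)}=1$. *)

(* Defs.v *)
From mathcomp Require Import all_boot all_order all_algebra.

Set Implicit Arguments.
Unset Strict Implicit.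
Unset Printing Implicit Defensive.

Import GRing.Theory.

Definition sigma (n : nat) : nat := \sum_(d <- divisors n) d.

Local Open Scope ring_scope.

Definition abundancy (n : nat) : rat := (sigma n)%:R / n%:R.

(* Meant for positive m and n; positivity is a separate hypothesis wherever
   this is used. *)
Definition feebly_amicable (m n : nat) : Prop :=
  n%:R / (sigma n)%:R + m%:R / (sigma m)%:R = 1 :> rat.

Lemma feebly_amicableE (m n : nat) :
  feebly_amicable m n <-> 1 / abundancy n + 1 / abundancy m = 1.
Proof. by rewrite /feebly_amicable /abundancy !div1r !invf_div. Qed.

(* Main.v *)
Require Import Defs.
From mathcomp Require Import all_boot all_order all_algebra.
From mathcomp Require Import ring.

(** If [l] is feebly amicable with [n], then [l / sigma l = m / k], so the
    coprimality of [k] and [m] forces [l = m * q], and [sigma l = k * q].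
    But [sigma (m * q) >= sigma m * q > k * q]. *)

Import GRing.Theory Num.Theory.

Local Open Scope ring_scope.

(** Multiplication by [q] maps the divisors of [m] injectively to divisors of [m * q], so
    [sigma m * q] is a partial sum of [sigma (m * q)]. In other words, abundancy does not decrease
    when passing to a multiple. *)
Lemma sigma_mul_ge (m q : nat) :
  (0 < m)%N -> (0 < q)%N -> (sigma m * q <= sigma (m * q))%N.
Proof.
move=> m_gt0 q_gt0; rewrite /sigma big_distrl /=.
(* Reindexed over the scaled divisors, both sides sum the identity, so inclusion of duplicate-free
   lists suffices. *)
rewrite -(big_map (muln^~ q) xpredT id) /=.
apply: (@uniq_sub_le_big _ addn leq leqnn (fun x y => leq_addr y x)).
- rewrite map_inj_uniq ?divisors_uniq // => x y /eqP.
  by rewrite eqn_pmul2r // => /eqP.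
- exact: divisors_uniq.
- move=> x /mapP[d]; rewrite -!dvdn_divisors ?muln_gt0 ?m_gt0 // => dm ->.
  by rewrite dvdn_mul.
Qed.

Lemma sigma_gt0 (n : nat) : (0 < n)%N -> (0 < sigma n)%N.
Proof.
by move=> n_gt0; rewrite /sigma (big_rem n) ?divisors_id // addn_gt0 n_gt0.
Qed.

Theorem theorem8p1 (k m n : nat)
  (k_gt0 : (0 < k)%N) (m_gt0 : (0 < m)%N) (n_gt0 : (0 < n)%N)
  (co_km : gcdn k m = 1%N) (lt_mk : (m < k)%N) (lt_k_sigma : (k < sigma m)%N)
  (lambda_n : abundancy n = k%:R / (k%:R - m%:R)) :
  ~ exists l : nat, [/\ (0 < l)%N, l <> n & feebly_amicable n l].
Proof.
case=> l [l_gt0 _ amic_nl].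
have nat_neq0 (i : nat) : (0 < i)%N -> i%:R != 0 :> rat.
  by rewrite pnatr_eq0 lt0n.
have k_neq0 := nat_neq0 _ k_gt0.
have sl_neq0 := nat_neq0 _ (sigma_gt0 _ l_gt0).
(* The ratio of [n] is [(k - m) / k], the inverse of its abundancy; that of [l] is the complement to
   1. *)
have ratio_l : l%:R / (sigma l)%:R = m%:R / k%:R :> rat.
  have ratio_n : n%:R / (sigma n)%:R = (k%:R - m%:R) / k%:R :> rat.
    by rewrite -invf_div -/(abundancy n) lambda_n invf_div.
  move: amic_nl; rewrite /feebly_amicable ratio_n => /(canRL (addrK _)) ->.
  by field.
have lk_eq : (l * k = m * sigma l)%N.
  by move/eqP: ratio_l; rewrite eqr_div // -!natrM eqr_nat => /eqP.
(* Gauss's lemma: [m] divides [l * k] and is coprime to [k]. *)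
have /dvdnP[q l_eq] : (m %| l)%N.
  by rewrite -(@Gauss_dvdl m l k) ?lk_eq ?dvdn_mulr // coprime_sym /coprime co_km.
have q_gt0 : (0 < q)%N by move: l_gt0; rewrite l_eq muln_gt0 => /andP[].
have sigma_l : sigma l = (k * q)%N.
  apply/eqP; rewrite -(eqn_pmul2l m_gt0) -lk_eq l_eq.
  by rewrite [(q * m)%N]mulnC -mulnA [(q * k)%N]mulnC.
(* Cancelling [q] leaves [sigma m <= k], against [lt_k_sigma]. *)
have := sigma_mul_ge _ _ m_gt0 q_gt0.
by rewrite [(m * q)%N]mulnC -l_eq sigma_l leq_pmul2r // leqNgt lt_k_sigma.
Qed.
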